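(* For every variety $\mathscr{V}$ of $\Delta$-continuous algebras, the free-algebra monad $\mathbb{T}_{\mathscr{V}}$ on $\mathbf{DCPO}$ (the monad of the adjunction $F_{\mathscr{V}}\dashv U_{\mathscr{V}}$, where $U_{\mathscr{V}}:\mathscr{V}\to\mathbf{DCPO}$ is the forgetful functor) is strongly finitary.
   Context: A dcpo is a poset with joins of directed (nonempty) subsets; $\mathbf{DCPO}$ is the category of dcpos and $\Delta$-continuous maps (monotone maps preserving directed joins), cartesian closed with pointwise ordered $[A,B]$. Functors are $\mathbf{DCPO}$-enriched, i.e. locally $\Delta$-continuous. Let $K:\mathbf{Set}_{fin}\to\mathbf{DCPO}$ embed finite sets as finite discrete dcpos. An enriched endofunctor $T$ of $\mathbf{DCPO}$ is strongly finitary if $T=\mathrm{Lan}_K(T\circ K)$ (enriched left Kan extension); a monad is strongly finitary if its underlying functor is. $\Sigma$ is a finitary signature (each symbol has an arity in $\mathbb{N}$), $V$ a countably infinite set of variables. If $\Sigma$ has $\alpha$ operation symbols, $\|\Sigma\|=2^{\alpha+\aleph_0}$. A $\Delta$-continuous algebra is a dcpo $A$ with $\Delta$-continuous operations $\sigma_A:A^n\to A$ for each $n$-ary $\sigma\in\Sigma$; $\Sigma\text{-}\mathbf{DCPO}$ is the category of $\Delta$-continuous algebras and $\Delta$-continuous homomorphisms. The set $\mathcal{T}^\Delta_\Sigma V$ of ($\Delta$-extended) terms is the smallest set such that (1) every variable is a term; (2) for $\sigma$ $n$-ary and terms $t_i$ ($i<n$), $\sigma(t_i)_{i<n}$ is a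 term; (3) for every nonzero ordinal $\alpha\le\|\Sigma\|$, every collection $t_k$ ($k<\alpha$) of terms which all together contain only finitely many variables yields a term (formal join) $\bigvee_{k<\alpha}t_k$. For an interpretation $f:V\to A$ the partial function $f^\sharp:\mathcal{T}^\Delta_\Sigma V\rightharpoonup A$ is: $f^\sharp(x)=f(x)$; $f^\sharp(\sigma(t_i)_{i<n})$ is defined iff all $f^\sharp(t_i)$ are, and is then $\sigma_A(f^\sharp(t_i))_{i<n}$; $f^\sharp(\bigvee_{k<\alpha}t_k)$ is defined iff all $f^\sharp(t_k)$ are defined and $f^\sharp(t_k)\sqsubseteq f^\sharp(t_l)$ for all $k\le l<\alpha$, and is then $\bigsqcup_{k<\alpha}f^\sharp(t_k)$. A variety of $\Delta$-continuous algebras is a full subcategory $\mathscr{V}$ of $\Sigma\text{-}\mathbf{DCPO}$ presented by a set of equations $t=t'$ between such terms: $A\in\mathscr{V}$ iff for each of these equations and every $f:V\to A$ both $f^\sharp(t)$ and $f^\sharp(t')$ are defined and equal. For every variety the forgetful functor $U_{\mathscr{V}}$ has a left adjoint $F_{\mathscr{V}}$. *)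

(* Defs.v *)
From Stdlib Require Import Relation_Definitions.
From mathcomp Require Import all_boot.
From mathcomp Require Import boolp classical_sets functions cardinality.

Set Implicit Arguments.
Unset Strict Implicit.
Unset Printing Implicit Defensive.

Local Open Scope classical_set_scope.
Local Open Scope card_scope.

Section Lub.
Variables (T : Type) (le : relation T).

Definition directed (P : set T) : Prop :=
  P !=set0 /\ forall x y, P x -> P y -> exists z, [/\ P z, le x z & le y z].

Definition is_lub (P : set T) (s : T) : Prop :=
  (forall x, P x -> le x s) /\ forall u, (forall x, P x -> le x u) -> le s u.
End Lub.

(* The carrier may be empty, and no least element is required. *)
Record dcpo := Dcpo {
  car :> Type;
  dle : car -> car -> Prop;
  dle_order : Relation_Definitions.order car dle;
  dle_complete : forall P, directed dle P -> exists s, is_lub dle P s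
}.
Arguments dle {_}.

Notation "x ⊑ y" := (dle x y) (at level 70, no associativity).

Lemma dle_refl (D : dcpo) (x : D) : x ⊑ x.
Proof. by case: (dle_order D). Qed.

Lemma dle_trans (D : dcpo) (x y z : D) : x ⊑ y -> y ⊑ z -> x ⊑ z.
Proof. by case: (dle_order D) => _ + _; apply. Qed.

Lemma dle_anti (D : dcpo) (x y : D) : x ⊑ y -> y ⊑ x -> x = y.
Proof. by case: (dle_order D) => _ _; apply. Qed.

Lemma lub_unique (D : dcpo) (P : set D) (s t : D) :
  is_lub dle P s -> is_lub dle P t -> s = t.
Proof. by move=> [sP sm] [tP tm]; apply: dle_anti; [apply: sm|apply: tm]. Qed.

Definition monotone (A B : dcpo) (f : A -> B) : Prop :=
  forall x y, x ⊑ y -> f x ⊑ f y.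

Definition continuous (A B : dcpo) (f : A -> B) : Prop :=
  monotone f /\
  forall (P : set A) s, directed dle P -> is_lub dle P s ->
    is_lub dle (f @` P) (f s).

Lemma directed_image (A B : dcpo) (f : A -> B) (P : set A) :
  monotone f -> directed dle P -> directed dle (f @` P).
Proof.
move=> fm [[x Px] dP]; split; first by exists (f x), x.
move=> _ _ [a Pa <-] [b Pb <-]; have [c [Pc ac bc]] := dP _ _ Pa Pb.
by exists (f c); split; [exists c|apply: fm|apply: fm].
Qed.

Record cmap (A B : dcpo) := Cmap {
  cfun :> A -> B;
  cfunP : continuous cfun
}.

Lemma cmap_ext (A B : dcpo) (f g : cmap A B) : (forall x, f x = g x) -> f = g.
Proof.
case: f g => f fc [g gc] /= /funext fg; subst g.
by rewrite (Prop_irrelevance fc gc).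
Qed.

Lemma cmap_mono (A B : dcpo) (f : cmap A B) : monotone f.
Proof. by case: (cfunP f). Qed.

Lemma cmap_lub (A B : dcpo) (f : cmap A B) (P : set A) s :
  directed dle P -> is_lub dle P s -> is_lub dle (f @` P) (f s).
Proof. by case: (cfunP f) => _; apply. Qed.

Lemma discrete_order (T : Type) : Relation_Definitions.order T eq.
Proof. by split=> [x|x y z -> ->|x y ->]. Qed.

Lemma discrete_complete (T : Type) (P : set T) :
  directed eq P -> exists s, is_lub eq P s.
Proof.
move=> [[x Px] dP]; exists x; split=> [y Py|u]; last exact.
by have [z [_ -> ->]] := dP _ _ Py Px.
Qed.

Definition discrete (T : Type) : dcpo :=
  Dcpo (@discrete_order T) (@discrete_complete T).

Section Power.
Variables (I : Type) (D : dcpo).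
Definition power_le : relation (I -> D) := fun f g => forall i, f i ⊑ g i.

Lemma power_order : Relation_Definitions.order (I -> D) power_le.
Proof.
split=> [f i|f g h fg gh i|f g fg gf]; first exact: dle_refl.
  exact: dle_trans (fg i) (gh i).
by apply: funext => i; apply: dle_anti; [apply: fg|apply: gf].
Qed.

Lemma power_directed (P : set (I -> D)) i :
  directed power_le P -> directed dle ((fun f => f i) @` P).
Proof.
move=> [[x Px] dP]; split; first by exists (x i), x.
move=> _ _ [a Pa <-] [b Pb <-]; have [c [Pc ac bc]] := dP _ _ Pa Pb.
by exists (c i); split; [exists c|apply: ac|apply: bc].
Qed.

Lemma power_lubP (P : set (I -> D)) (s : I -> D) :
  (forall i, is_lub dle ((fun f => f i) @` P) (s i)) -> is_lub power_le P s.
Proof.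
move=> sP; split=> [f Pf i|u uP i]; first by apply: (sP i).1; exists f.
by apply: (sP i).2 => _ [f Pf <-]; apply: uP.
Qed.

Lemma power_complete (P : set (I -> D)) :
  directed power_le P -> exists s, is_lub power_le P s.
Proof.
move=> dP.
have /choice[s sP] i := dle_complete (power_directed i dP).
by exists s; exact: power_lubP.
Qed.

Definition power : dcpo := Dcpo power_order power_complete.

Lemma power_lub_at (P : set power) (s : power) i :
  directed dle P -> is_lub dle P s -> is_lub dle ((fun f => f i) @` P) (s i).
Proof.
move=> dP sP.
have /choice[t tP] j := dle_complete (power_directed j dP).
by rewrite (lub_unique sP (power_lubP tP : is_lub (@dle power) P t)).
Qed.
End Power.

Section Prod.
Variables A B : dcpo.
Definition prod_le : relation (A * B) :=
  fun x y => x.1 ⊑ y.1 /\ x.2 ⊑ y.2.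

Lemma prod_order : Relation_Definitions.order (A * B) prod_le.
Proof.
split=> [x|x y z [? ?] [? ?]|[a b] [c d] [/= ? ?] [/= ? ?]].
- by split; apply: dle_refl.
- by split; apply: dle_trans; eassumption.
- by congr pair; apply: dle_anti.
Qed.

Lemma prod_directed (P : set (A * B)) :
  directed prod_le P -> directed dle (fst @` P) /\ directed dle (snd @` P).
Proof.
move=> [[x Px] dP]; split; (split; first by eexists; exists x);
  move=> _ _ [a Pa <-] [b Pb <-]; have [c [Pc [? ?] [? ?]]] := dP _ _ Pa Pb.
- by exists c.1; split=> //; exists c.
- by exists c.2; split=> //; exists c.
Qed.

Lemma prod_lubP (P : set (A * B)) s :
  is_lub dle (fst @` P) s.1 -> is_lub dle (snd @` P) s.2 -> is_lub prod_le P s.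
Proof.
move=> [u1 l1] [u2 l2]; split=> [x Px|u uP].
  by split; [apply: u1|apply: u2]; exists x.
by split; [apply: l1|apply: l2] => _ [x Px <-]; case: (uP x Px).
Qed.

Lemma prod_complete (P : set (A * B)) :
  directed prod_le P -> exists s, is_lub prod_le P s.
Proof.
move=> /prod_directed[/dle_complete[a aP] /dle_complete[b bP]].
by exists (a, b); exact: prod_lubP.
Qed.

Definition prod_dcpo : dcpo := Dcpo prod_order prod_complete.

Lemma prod_lub_at (P : set prod_dcpo) s : directed dle P -> is_lub dle P s ->
  is_lub dle (fst @` P) s.1 /\ is_lub dle (snd @` P) s.2.
Proof.
move=> dP sP; have [/dle_complete[a aP] /dle_complete[b bP]] := prod_directed dP.
by rewrite (lub_unique sP
  (prod_lubP (s := (a, b)) aP bP : is_lub (@dle prod_dcpo) P _)).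
Qed.
End Prod.

Section Sub.
Variables (D : dcpo) (Q : set D).
Definition lub_closed : Prop := forall (P : set D) s,
  P `<=` Q -> directed dle P -> is_lub dle P s -> Q s.
Hypothesis Qcl : lub_closed.

Definition sub_le : relation {x | Q x} := fun x y => sval x ⊑ sval y.

Lemma sub_order : Relation_Definitions.order {x | Q x} sub_le.
Proof.
split=> [x|x y z|[x Qx] [y Qy] xy yx]; first exact: dle_refl.
  exact: dle_trans.
by apply: eq_exist; exact: dle_anti xy yx.
Qed.

Lemma sub_directed (P : set {x | Q x}) :
  directed sub_le P -> directed dle (sval @` P).
Proof.
move=> [[x Px] dP]; split; first by exists (sval x), x.
move=> _ _ [a Pa <-] [b Pb <-]; have [c [Pc ? ?]] := dP _ _ Pa Pb.
by exists (sval c); split=> //; exists c.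
Qed.

Lemma sub_lubP (P : set {x | Q x}) s :
  is_lub dle (sval @` P) (sval s) -> is_lub sub_le P s.
Proof.
move=> [us ls]; split=> [x Px|u uP]; first by apply: us; exists x.
by apply: ls => _ [x Px <-]; apply: uP.
Qed.

Lemma sub_complete_lub (P : set {x | Q x}) : directed sub_le P ->
  exists s : {x | Q x}, is_lub dle (sval @` P) (sval s).
Proof.
move=> /sub_directed dP; have [s sP] := dle_complete dP.
have Qs : Q s by apply: Qcl dP sP => _ [[x Qx] _ <-].
by exists (exist _ s Qs).
Qed.

Lemma sub_complete (P : set {x | Q x}) :
  directed sub_le P -> exists s, is_lub sub_le P s.
Proof. by move=> /sub_complete_lub[s sP]; exists s; exact: sub_lubP. Qed.

Definition sub_dcpo : dcpo := Dcpo sub_order sub_complete.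

Lemma sub_lub_at (P : set sub_dcpo) s : directed dle P -> is_lub dle P s ->
  is_lub dle (sval @` P) (sval s).
Proof.
move=> dP sP; have [t tP] := sub_complete_lub dP.
by rewrite (lub_unique sP (sub_lubP tP : is_lub (@dle sub_dcpo) P t)).
Qed.
End Sub.

Section FunctionSpace.
Variables A B : dcpo.
Definition cmap_le : relation (cmap A B) := fun f g => forall x, f x ⊑ g x.

Lemma cmap_order : Relation_Definitions.order (cmap A B) cmap_le.
Proof.
split=> [f x|f g h fg gh x|f g fg gf]; first exact: dle_refl.
  exact: dle_trans (fg x) (gh x).
by apply: cmap_ext => x; apply: dle_anti; [apply: fg|apply: gf].
Qed.

Lemma cmap_directed (P : set (cmap A B)) x :
  directed cmap_le P -> directed dle ((fun f : cmap A B => f x) @` P).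
Proof.
move=> [[f Pf] dP]; split; first by exists (f x), f.
move=> _ _ [a Pa <-] [b Pb <-]; have [c [Pc ac bc]] := dP _ _ Pa Pb.
by exists (c x); split; [exists c|apply: ac|apply: bc].
Qed.

Lemma cmap_lubP (P : set (cmap A B)) (s : cmap A B) :
  (forall x, is_lub dle ((fun f : cmap A B => f x) @` P) (s x)) ->
  is_lub cmap_le P s.
Proof.
move=> sP; split=> [f Pf x|u uP x]; first by apply: (sP x).1; exists f.
by apply: (sP x).2 => _ [f Pf <-]; apply: uP.
Qed.

Lemma cmap_complete_lub (P : set (cmap A B)) : directed cmap_le P ->
  exists s : cmap A B,
    forall x, is_lub dle ((fun f : cmap A B => f x) @` P) (s x).
Proof.
move=> dP; have /choice[s sP] x := dle_complete (cmap_directed x dP).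
have sm : monotone s.
  move=> x y xy; apply: (sP x).2 => _ [f Pf <-].
  by apply: dle_trans (cmap_mono f xy) _; apply: (sP y).1; exists f.
suff sc : continuous s by exists (Cmap sc).
split=> // Q q dQ qQ; split=> [_ [x Qx <-]|u uQ]; first exact/sm/qQ.1.
apply: (sP q).2 => _ [f Pf <-]; apply: (cmap_lub f dQ qQ).2 => _ [x Qx <-].
by apply: (@dle_trans _ _ (s x)); [apply: (sP x).1; exists f|apply: uQ; exists x].
Qed.

Lemma cmap_complete (P : set (cmap A B)) :
  directed cmap_le P -> exists s, is_lub cmap_le P s.
Proof. by move=> /cmap_complete_lub[s sP]; exists s; exact: cmap_lubP. Qed.

Definition cmap_dcpo : dcpo := Dcpo cmap_order cmap_complete.

Lemma cmap_lub_at (P : set cmap_dcpo) (s : cmap_dcpo) x :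
  directed dle P -> is_lub dle P s ->
  is_lub dle ((fun f : cmap_dcpo => f x) @` P) (s x).
Proof.
move=> dP sP; have [t tP] := cmap_complete_lub dP.
by rewrite (lub_unique sP (cmap_lubP tP : is_lub (@dle cmap_dcpo) P t)).
Qed.
End FunctionSpace.

Lemma id_continuous (A : dcpo) : continuous (@id A).
Proof. by split=> // P s _; rewrite image_id. Qed.

Definition cid_map (A : dcpo) : cmap A A := Cmap (id_continuous A).

Lemma comp_continuous (A B C : dcpo) (g : cmap B C) (f : cmap A B) :
  continuous (g \o f).
Proof.
split=> [x y xy|P s dP sP]; first exact/cmap_mono/cmap_mono.
rewrite -image_comp; apply: cmap_lub; last exact: cmap_lub.
exact: directed_image (@cmap_mono _ _ f) dP.
Qed.

Definition ccomp (A B C : dcpo) (g : cmap B C) (f : cmap A B) : cmap A C :=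
  Cmap (comp_continuous g f).

Lemma ccomp_continuous (A B C : dcpo) :
  @continuous (prod_dcpo (cmap_dcpo B C) (cmap_dcpo A B)) (cmap_dcpo A C)
    (fun p => ccomp p.1 p.2).
Proof.
have mono : @monotone (prod_dcpo (cmap_dcpo B C) (cmap_dcpo A B))
    (cmap_dcpo A C) (fun p => ccomp p.1 p.2).
  move=> [g f] [g' f'] [/= gg ff] x /=.
  exact: dle_trans (cmap_mono g (ff x)) (gg _).
split=> // P [g f] dP sP; have [gP fP] := prod_lub_at dP sP.
have [dg df] := prod_directed dP.
split=> [_ [p Pp <-]|u uP x /=]; first exact/mono/sP.1.
apply: (cmap_lub_at _ dg gP).2 => _ [_ [[g1 f1] P1 <-] <-] /=.
apply: (cmap_lub g1 (cmap_directed x df) (cmap_lub_at x df fP)).2.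
move=> _ [_ [_ [[g2 f2] P2 <-] <-] <-] /=.
have [[g3 f3] [P3 [/= g13 f13] [/= g23 f23]]] := dP.2 _ _ P1 P2.
apply: (@dle_trans _ _ (g3 (f3 x))).
  exact: dle_trans (cmap_mono g1 (f23 x)) (g13 _).
by apply: (uP (ccomp g3 f3)); exists (g3, f3).
Qed.

Record dcat := Dcat {
  obj :> Type;
  hom : obj -> obj -> dcpo;
  idm : forall a, hom a a;
  dcomp : forall a b c, cmap (prod_dcpo (hom b c) (hom a b)) (hom a c);
  dcomp_idl : forall a b (f : hom a b), dcomp a b b (idm b, f) = f;
  dcomp_idr : forall a b (f : hom a b), dcomp a a b (f, idm a) = f;
  dcomp_assoc : forall a b c d (h : hom c d) (g : hom b c) (f : hom a b),
    dcomp a c d (h, dcomp a b c (g, f)) = dcomp a b d (dcomp b c d (h, g), f)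
}.
Arguments hom {_}.
Arguments idm {_}.

Definition compose (C : dcat) (a b c : C) (g : hom b c) (f : hom a b)
  : hom a c := dcomp a b c (g, f).

Notation "g ∘ f" := (compose g f) (at level 40, left associativity).

Lemma composeA (C : dcat) (a b c d : C) (h : hom c d) (g : hom b c)
  (f : hom a b) : h ∘ (g ∘ f) = h ∘ g ∘ f.
Proof. exact: dcomp_assoc. Qed.

Lemma compose1m (C : dcat) (a b : C) (f : hom a b) : idm b ∘ f = f.
Proof. exact: dcomp_idl. Qed.

Lemma composem1 (C : dcat) (a b : C) (f : hom a b) : f ∘ idm a = f.
Proof. exact: dcomp_idr. Qed.

Record dfunctor (C D : dcat) := Dfunctor {
  fobj :> C -> D;
  fmap : forall a b, cmap (hom a b) (hom (fobj a) (fobj b));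
  fmap_id : forall a, fmap a a (idm a) = idm (fobj a);
  fmap_comp : forall a b c (g : hom b c) (f : hom a b),
    fmap a c (g ∘ f) = fmap b c g ∘ fmap a b f
}.
Arguments fmap {_ _} _ {_ _}.

Definition functor_id (C : dcat) : dfunctor C C :=
  @Dfunctor C C id (fun a b => cid_map (hom a b))
    (fun a => erefl) (fun a b c g f => erefl).

Section FunctorComp.
Variables (C D E : dcat) (G : dfunctor D E) (F : dfunctor C D).

Lemma functor_comp_id (a : C) :
  ccomp (fmap G) (fmap F) (idm a) = idm (G (F a)).
Proof. by rewrite /= !fmap_id. Qed.

Lemma functor_comp_comp (a b c : C) (g : hom b c) (f : hom a b) :
  ccomp (fmap G) (fmap F) (g ∘ f) =
  ccomp (fmap G) (fmap F) g ∘ ccomp (fmap G) (fmap F) f.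
Proof. by rewrite /= !fmap_comp. Qed.

Definition functor_comp : dfunctor C E :=
  @Dfunctor C E (fun a => G (F a)) (fun a b => ccomp (fmap G) (fmap F))
    functor_comp_id functor_comp_comp.
End FunctorComp.

(* Enriched naturality is plain naturality, since DCPO(1, -) is faithful. *)
Record dnat (C D : dcat) (F G : dfunctor C D) := Dnat {
  component :> forall a, hom (F a) (G a);
  naturality : forall a b (f : hom a b),
    component b ∘ fmap F f = fmap G f ∘ component a
}.

Lemma nat_id_naturality (C D : dcat) (F : dfunctor C D) a b (f : hom a b) :
  idm (F b) ∘ fmap F f = fmap F f ∘ idm (F a).
Proof. by rewrite compose1m composem1. Qed.

Definition nat_id (C D : dcat) (F : dfunctor C D) : dnat F F :=
  Dnat (@nat_id_naturality C D F).

Record adjunction (C D : dcat) (F : dfunctor C D) (U : dfunctor D C) :=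
  Adjunction {
  adj_unit : dnat (functor_id C) (functor_comp U F);
  adj_counit : dnat (functor_comp F U) (functor_id D);
  triangleL : forall x : C, adj_counit (F x) ∘ fmap F (adj_unit x) = idm (F x);
  triangleR : forall a : D, fmap U (adj_counit a) ∘ adj_unit (U a) = idm (U a)
}.

Record monad (C : dcat) := Monad {
  mfunctor :> dfunctor C C;
  munit : dnat (functor_id C) mfunctor;
  mmult : dnat (functor_comp mfunctor mfunctor) mfunctor;
  munitl : forall x : C, mmult x ∘ munit (mfunctor x) = idm (mfunctor x);
  munitr : forall x : C, mmult x ∘ fmap mfunctor (munit x) = idm (mfunctor x);
  massoc : forall x : C,
    mmult x ∘ mmult (mfunctor x) = mmult x ∘ fmap mfunctor (mmult x)
}.

Section MonadOfAdjunction.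
Variables (C D : dcat) (F : dfunctor C D) (U : dfunctor D C).
Variable adj : adjunction F U.
Let T := functor_comp U F.
Let mu (x : C) : hom (T (T x)) (T x) := fmap U (adj_counit adj (F x)).

Lemma mu_naturality (x y : C) (f : hom x y) :
  mu y ∘ fmap (functor_comp T T) f = fmap T f ∘ mu x.
Proof.
rewrite /mu /= -!fmap_comp; congr (fmap U _).
exact: (naturality (adj_counit adj) (fmap F f)).
Qed.

Definition adj_mult : dnat (functor_comp T T) T := Dnat mu_naturality.

Lemma adj_munitl (x : C) : adj_mult x ∘ adj_unit adj (T x) = idm (T x).
Proof. exact: (triangleR adj (F x)). Qed.

Lemma adj_munitr (x : C) : adj_mult x ∘ fmap T (adj_unit adj x) = idm (T x).
Proof. by rewrite /= /mu -fmap_comp (triangleL adj) fmap_id. Qed.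

Lemma adj_massoc (x : C) :
  adj_mult x ∘ adj_mult (T x) = adj_mult x ∘ fmap T (adj_mult x).
Proof.
rewrite /= /mu -!fmap_comp; congr (fmap U _).
exact/esym/(naturality (adj_counit adj) (adj_counit adj (F x))).
Qed.

Definition monad_of_adjunction : monad C :=
  Monad adj_munitl adj_munitr adj_massoc.
End MonadOfAdjunction.

(* [lan_cocone K G x y] is the underlying set of the dcpo
   [A^op, DCPO](C(K -, x), B(G -, y)); its order is pointwise. *)
Record lan_cocone (A B C : dcat) (K : dfunctor A C) (G : dfunctor A B)
    (x : C) (y : B) := LanCocone {
  leg :> forall a, cmap (hom (K a) x) (hom (G a) y);
  leg_natural : forall a a' (f : hom a a') (u : hom (K a') x),
    leg a (u ∘ fmap K f) = leg a' u ∘ fmap G f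
}.

(* [theta] exhibits [L] as the (pointwise) enriched left Kan extension of [G]
   along [K]: for all x, restriction along [theta] is an isomorphism of dcpos
     B(L x, y) ~ [A^op, DCPO](C(K -, x), B(G -, y)),
   i.e. L x is the colimit of G weighted by C(K -, x).  An isomorphism of dcpos
   is a surjection that preserves and reflects the order. *)
Definition is_lan (A B C : dcat) (K : dfunctor A C) (G : dfunctor A B)
    (L : dfunctor C B) (theta : dnat G (functor_comp L K)) : Prop :=
  forall (x : C) (y : B),
    let restrict (h : hom (L x) y) (a : A) (u : hom (K a) x) : hom (G a) y :=
      h ∘ (fmap L u ∘ theta a) in
    (forall h h' : hom (L x) y,
       h ⊑ h' <-> forall a u, restrict h a u ⊑ restrict h' a u) /\
    (forall alpha : lan_cocone K G x y,
       exists h : hom (L x) y, forall a u, restrict h a u = alpha a u).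

Definition DCPO : dcat.
Proof.
refine (@Dcat dcpo cmap_dcpo cid_map (fun A B C => Cmap (@ccomp_continuous A B C))
  _ _ _).
- by move=> A B f; apply: cmap_ext.
- by move=> A B f; apply: cmap_ext.
- by move=> A B C D h g f; apply: cmap_ext.
Defined.

Lemma discrete_continuous (A B : dcpo) (f : A -> B) :
  (forall x y : A, x ⊑ y -> x = y) -> continuous f.
Proof.
move=> dA; split=> [x y /dA->|P s [[x Px] _] [us _]]; first exact: dle_refl.
have Ps y : P y -> y = s by move=> /us/dA.
split=> [_ [y /Ps-> <-]|u]; first exact: dle_refl.
by apply; exists x => //; rewrite (Ps x Px).
Qed.

Lemma Setfin_comp_continuous (A B C : finType) :
  @continuous (prod_dcpo (discrete (B -> C)) (discrete (A -> B)))
    (discrete (A -> C)) (fun p => p.1 \o p.2).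
Proof. by apply: discrete_continuous => -[? ?] [? ?] [/= -> ->]. Qed.

(* An ordinary category, seen as a DCPO-category with discrete hom-dcpos. *)
Definition Setfin : dcat.
Proof.
refine (@Dcat finType (fun A B => discrete (A -> B)) (fun A => id)
  (fun A B C => Cmap (@Setfin_comp_continuous A B C)) _ _ _) => //.
Defined.

Lemma K_map_continuous (A B : finType) (f : A -> B) :
  @continuous (discrete A) (discrete B) f.
Proof. exact: discrete_continuous. Qed.

Lemma K_fmap_continuous (A B : finType) :
  @continuous (discrete (A -> B)) (cmap_dcpo (discrete A) (discrete B))
    (fun f => Cmap (K_map_continuous f)).
Proof. exact: discrete_continuous. Qed.

Definition K : dfunctor Setfin DCPO.
Proof.
refine (@Dfunctor Setfin DCPO (fun A => discrete A)
  (fun A B => Cmap (@K_fmap_continuous A B)) _ _).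
- by move=> A; apply: cmap_ext.
- by move=> A B C g f; apply: cmap_ext.
Defined.

Definition strongly_finitary (T : dfunctor DCPO DCPO) : Prop :=
  is_lan (K := K) (L := T) (nat_id (functor_comp T K)).

Definition strongly_finitary_monad (M : monad DCPO) : Prop :=
  strongly_finitary (mfunctor M).

Record signature := Signature {
  symbol :> Type;
  arity : symbol -> nat
}.

Record algebra (S : signature) := Algebra {
  alg_car :> dcpo;
  alg_op : forall s : S, cmap (power 'I_(arity s) alg_car) alg_car
}.
Arguments alg_op {S} a s.

Section AlgebraCategory.
Variable S : signature.

Definition is_hom (A B : algebra S) (f : cmap A B) : Prop :=
  forall (s : S) (a : 'I_(arity s) -> A),
    f (alg_op A s a) = alg_op B s (fun i => f (a i)).

Lemma is_hom_lub_closed (A B : algebra S) :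
  @lub_closed (cmap_dcpo A B) (@is_hom A B).
Proof.
move=> P f PH dP fP s a.
apply: (lub_unique (cmap_lub_at _ dP fP)).
pose ev (g : cmap_dcpo A B) : power 'I_(arity s) B := fun i => g (a i).
have evm : monotone ev by move=> g h gh i; apply: gh.
have evP : is_lub dle (ev @` P) (ev f).
  apply: power_lubP => i; rewrite image_comp; exact: cmap_lub_at dP fP.
have := cmap_lub (alg_op B s) (directed_image evm dP) evP.
rewrite image_comp; congr (is_lub _ _ _).
by apply: eq_imagel => g Pg /=; rewrite PH.
Qed.

Definition alg_hom (A B : algebra S) : dcpo := sub_dcpo (@is_hom_lub_closed A B).

Lemma alg_hom_ext (A B : algebra S) (f g : alg_hom A B) :
  sval f = sval g -> f = g.
Proof. by case: f g => f ? [g ?]; exact: eq_exist. Qed.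

Lemma alg_id_is_hom (A : algebra S) : is_hom (cid_map A).
Proof. by []. Qed.

Definition alg_id (A : algebra S) : alg_hom A A :=
  exist _ (cid_map A) (@alg_id_is_hom A).

Lemma alg_comp_is_hom (A B C : algebra S) (g : alg_hom B C) (f : alg_hom A B) :
  is_hom (ccomp (sval g) (sval f)).
Proof. by move=> s a /=; rewrite (svalP f) (svalP g). Qed.

Definition alg_comp (A B C : algebra S)
  (p : prod_dcpo (alg_hom B C) (alg_hom A B)) : alg_hom A C :=
  exist _ (ccomp (sval p.1) (sval p.2)) (alg_comp_is_hom p.1 p.2).

Lemma alg_comp_continuous (A B C : algebra S) : continuous (@alg_comp A B C).
Proof.
have [ccm ccl] := ccomp_continuous A B C.
pose v (p : prod_dcpo (alg_hom B C) (alg_hom A B))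
  : prod_dcpo (cmap_dcpo B C) (cmap_dcpo A B) := (sval p.1, sval p.2).
have vm : monotone v by move=> p q [].
split=> [p q /vm/ccm //|P s dP sP].
have [s1 s2] := prod_lub_at dP sP; have [d1 d2] := prod_directed dP.
have vP : is_lub dle (v @` P) (v s).
  apply: prod_lubP; rewrite image_comp.
    by have := sub_lub_at d1 s1; rewrite image_comp.
  by have := sub_lub_at d2 s2; rewrite image_comp.
apply: sub_lubP; rewrite image_comp.
by have := ccl _ _ (directed_image vm dP) vP; rewrite image_comp.
Qed.

Definition AlgCat : dcat.
Proof.
refine (@Dcat (algebra S) alg_hom alg_id
  (fun A B C => Cmap (@alg_comp_continuous A B C)) _ _ _).
- by move=> A B f; apply/alg_hom_ext/cmap_ext.
- by move=> A B f; apply/alg_hom_ext/cmap_ext.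
- by move=> A B C D h g f; apply/alg_hom_ext/cmap_ext.
Defined.

Lemma forget_continuous (A B : algebra S) :
  @continuous (alg_hom A B) (cmap_dcpo A B) sval.
Proof. by split=> // P s; exact: sub_lub_at. Qed.

Definition forget : dfunctor AlgCat DCPO :=
  @Dfunctor AlgCat DCPO (@alg_car S)
    (fun A B => Cmap (@forget_continuous A B))
    (fun A => erefl) (fun A B C g f => erefl).
End AlgebraCategory.

Definition full_sub (C : dcat) (P : C -> Prop) : dcat :=
  @Dcat {a | P a} (fun a b => hom (sval a) (sval b)) (fun a => idm (sval a))
    (fun a b c => dcomp (sval a) (sval b) (sval c))
    (fun a b f => dcomp_idl f) (fun a b f => dcomp_idr f)
    (fun a b c d h g f => dcomp_assoc h g f).

Definition inclusion (C : dcat) (P : C -> Prop) : dfunctor (full_sub P) C :=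
  @Dfunctor (full_sub P) C sval (fun a b => cid_map (hom (sval a) (sval b)))
    (fun a => erefl) (fun a b c g f => erefl).

(* A type of cardinality ‖S‖ = 2^(|S| + aleph_0). *)
Definition sig_card (S : signature) : Type := (S + nat -> bool)%type.

(* A nonzero ordinal α ≤ ‖S‖, as a well-order whose underlying set is a subset
   of [sig_card S].  As ‖S‖ is an initial ordinal, α ≤ ‖S‖ means that every proper
   initial segment of α has cardinality strictly less than ‖S‖. *)
Record ordinal_le (S : signature) := OrdinalLe {
  ord_set : sig_card S -> Prop;
  ord_lt : set_type ord_set -> set_type ord_set -> Prop;
  ord_lt_wf : well_founded ord_lt;
  ord_lt_trans : Relation_Definitions.transitive _ ord_lt;
  ord_lt_total : forall k l, [\/ ord_lt k l, k = l | ord_lt l k];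
  ord_nonzero : ord_set !=set0;
  ord_bound : forall l,
    ~ ([set: sig_card S] #<= [set k | ord_lt k l])
}.

Definition ord_carrier (S : signature) (α : ordinal_le S) : Type :=
  set_type (ord_set α).
Coercion ord_carrier : ordinal_le >-> Sortclass.

Definition ord_leq (S : signature) (α : ordinal_le S) (k l : α) : Prop :=
  ord_lt k l \/ k = l.

(* Terms without the finiteness restriction on the variables of formal joins. *)
Inductive preterm (S : signature) (V : Type) : Type :=
| Var (x : V)
| Op (s : S) (t : 'I_(arity s) -> preterm S V)
| Join (α : ordinal_le S) (t : α -> preterm S V).
Arguments Var {S V}.
Arguments Op {S V}.
Arguments Join {S V}.

Section Terms.
Variables (S : signature) (V : Type).

Fixpoint vars (t : preterm S V) : set V :=
  match t with
  | Var x => [set x]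
  | Op s t => \bigcup_i vars (t i)
  | Join α t => \bigcup_k vars (t k)
  end.

Inductive is_term : preterm S V -> Prop :=
| is_term_var x : is_term (Var x)
| is_term_op (s : S) (t : 'I_(arity s) -> preterm S V) :
    (forall i, is_term (t i)) -> is_term (Op s t)
| is_term_join (α : ordinal_le S) (t : α -> preterm S V) :
    (forall k, is_term (t k)) -> finite_set (\bigcup_k vars (t k)) ->
    is_term (Join α t).

Definition term : Type := {t | is_term t}.

(* The graph of the partial function f^♯. *)
Fixpoint eval (A : algebra S) (f : V -> A) (t : preterm S V) : A -> Prop :=
  match t with
  | Var x => fun b => b = f x
  | Op s t => fun b => exists a : 'I_(arity s) -> A,
      (forall i, eval f (t i) (a i)) /\ b = alg_op A s a
  | Join α t => fun b => exists a : α -> A,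
      [/\ forall k, eval f (t k) (a k),
          forall k l, ord_leq k l -> a k ⊑ a l
        & is_lub dle (range a) b]
  end.

Lemma eval_functional (A : algebra S) (f : V -> A) (t : preterm S V) (a b : A) :
  eval f t a -> eval f t b -> a = b.
Proof.
elim: t a b => [x|s t IH|α t IH] a b /=; first by move=> -> ->.
- move=> [c [tc ->]] [d [td ->]]; congr (alg_op A s _).
  by apply: funext => i; exact: IH (tc i) (td i).
- move=> [c [tc _ ca]] [d [td _ db]].
  have cd : c = d by apply: funext => k; exact: IH (tc k) (td k).
  by subst d; exact: lub_unique ca db.
Qed.

(* Both sides are defined and equal. *)
Definition satisfies (A : algebra S) (e : term * term) : Prop :=
  forall f : V -> A, exists a, eval f (sval e.1) a /\ eval f (sval e.2) a.

Variable E : set (term * term).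

Definition in_variety (A : AlgCat S) : Prop :=
  forall e, E e -> satisfies A e.

Definition variety : dcat := full_sub in_variety.

Definition variety_forget : dfunctor variety DCPO :=
  functor_comp (forget S) (inclusion in_variety).
End Terms.

(* Main.v *)
Require Import Defs.
From mathcomp Require Import all_boot.
From mathcomp Require Import boolp classical_sets functions cardinality.

(** Let T be the free-algebra monad.  The left Kan extension L X of T K along K
    is generated, under directed joins, by the germs [u, t] of the pairs
    u : n -> X, t in T n, and everything below rests on transferring the algebra
    structure of the T n to L X.

    The dcpo L X is built concretely.  A continuous map from the Kan extension
    to a dcpo Y is a compatible family of continuous maps X^n x T n -> Y; the
    inverse image of a principal down-set of Y is an ideal: a predicate on
    the pairs (u, t) that is natural in n, downward closed and closed under
    directed joins.  Ideals form a complete lattice, and L X is the closure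
    under directed joins of the principal ideals in it.  The universal property
    (lan_descent) holds because the property that I is contained in the inverse
    image of the down-set of y for a least y passes to directed joins.

    An operation is applied to a tuple of ideals by applying it to tuples of
    pairs with the same u and generating an ideal.  That this is continuous, and
    sends the tuple of the [u, t_i] to [u, s(t_i)], follows from one fact
    (maps_into_closure): if s maps some families into an ideal J, it also maps
    the generated ideals into J.  One argument is replaced at a time, and for
    one argument the largest admissible family, a residual, is itself an ideal.
    Here finite discrete sets matter: two maps u : n -> X and v : m -> X
    combine into a single map n + m -> X.  So finitely many germs always come
    from a common stage (germs_common), and the tuples of germs from a common
    stage generate each finite power of L X.

    The equations of the variety hold in L X (lan_satisfies): the two sides of an
    equation involve only finitely many variables, they are defined and equal on
    a tuple of germs from a common stage because T n is in the variety, and the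
    interpretations for which they are defined and equal are closed under
    directed joins, as evaluation is continuous where it is defined (eval_lub).

    Thus L X is in the variety, and freeness yields a homomorphism
    e : T X -> L X with e (T u (t)) = [u, t], while the Kan extension yields
    r : L X -> T X with r [u, t] = T u (t), which is a homomorphism because it
    is one on germs.  Freeness gives r e = id.  A compatible family
    extends along e, and two maps on T X compare as soon as they do so on
    the elements T u (t), since germs generate L X. *)

Set Implicit Arguments.
Unset Strict Implicit.
Unset Printing Implicit Defensive.

(** * Directed joins and generation *)

Section Generation.
Local Open Scope classical_set_scope.

Lemma directed_finite (D : dcpo) (P : set D) k (a : 'I_k -> D) :
  directed dle P -> (forall i, P (a i)) -> exists2 z, P z & forall i, a i ⊑ z.
Proof.
move=> dP Pa.
suff H j : exists2 z, P z & forall i : 'I_k, i < j -> a i ⊑ z.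
  by have [z Pz az] := H k; exists z => // i; apply: az.
elim: j => [|j [z Pz az]]; first by have [[z Pz] _] := dP; exists z.
case: (ltnP j k) => [jk|kj]; last first.
  by exists z => // i _; apply: az; exact: leq_trans (ltn_ord i) kj.
have [w [Pw zw aw]] := dP.2 _ _ Pz (Pa (Ordinal jk)).
exists w => // i; rewrite ltnS leq_eqVlt => /orP[/eqP ij|/az iz].
  by have -> : i = Ordinal jk by exact: val_inj.
exact: dle_trans iz zw.
Qed.

Definition generates (D : dcpo) (B : set D) : Prop :=
  forall Q : set D, lub_closed Q -> B `<=` Q -> forall x, Q x.

Definition lub_hull (D : dcpo) (B : set D) : set D :=
  fun x => forall Q : set D, lub_closed Q -> B `<=` Q -> Q x.

Lemma lub_hull_closed (D : dcpo) (B : set D) : lub_closed (lub_hull B).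
Proof.
move=> P s PB dP sP Q Qcl BQ; apply: (Qcl P) => // x Px.
exact: PB Px _ Qcl BQ.
Qed.

Lemma lub_hull_sub (D : dcpo) (B : set D) : B `<=` lub_hull B.
Proof. by move=> x Bx Q _; apply. Qed.

(** Elements of the hull carry a membership proof, while the induction runs over D;
    the induction predicate therefore quantifies over these proofs. *)
Lemma lub_hull_generated (D : dcpo) (B : set D) :
  @generates (sub_dcpo (@lub_hull_closed D B)) [set x | B (sval x)].
Proof.
set H := sub_dcpo _ => Q Qcl BQ [x hx].
suff [_ Qx] : lub_hull B x /\ forall h, Q (exist _ x h) by exact: Qx.
apply: (hx (fun y => lub_hull B y /\ forall h, Q (exist _ y h))) =>
  [P s PQ dP sP|y By]; last first.
  by split=> [|h]; [exact: lub_hull_sub|exact: BQ].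
have Ps : lub_hull B s by apply: lub_hull_closed dP sP => y /PQ[].
split=> // h; pose P' : set H := [set y | P (sval y)].
have P'P : sval @` P' = P.
  apply/seteqP; split=> [_ [y Py <-] //|y Py].
  by have [hy _] := PQ _ Py; exists (exist _ y hy).
apply: (Qcl P') => [[y hy] /PQ[_] //||].
  have [[y Py] dP2] := dP; split.
    by have [hy _] := PQ _ Py; exists (exist _ y hy).
  move=> a b Pa Pb; have [c [Pc ac bc]] := dP2 _ _ Pa Pb.
  by have [hc _] := PQ _ Pc; exists (exist _ c hc).
by apply: sub_lubP; rewrite P'P.
Qed.

Lemma is_lub_const (D : dcpo) (P : set D) x :
  P !=set0 -> (forall y, P y -> y = x) -> is_lub dle P x.
Proof.
move=> [y Py] Px; split=> [z /Px-> |u]; first exact: dle_refl.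
by rewrite -(Px _ Py); apply.
Qed.

Lemma const_continuous (A D : dcpo) (x : D) : continuous (fun _ : A => x).
Proof.
split=> [y z _|P y [[z Pz] _] _]; first exact: dle_refl.
by apply: is_lub_const => [|_ [w _ <-]] //; exists x, z.
Qed.

Lemma power_continuous (A D : dcpo) I (f : A -> power I D) :
  (forall i, continuous (fun x => f x i)) -> continuous f.
Proof.
move=> fc; split=> [x y xy i|P s dP sP]; first exact: (fc i).1.
by apply: power_lubP => i; rewrite image_comp; exact: (fc i).2.
Qed.

(** The entries that are not in B are treated one at a time: a tuple with one
    free entry is a continuous function of that entry. *)
Lemma generates_power (D : dcpo) (B : set D) k (Q : set (power 'I_k D)) :
  generates B -> lub_closed Q -> (forall a, (forall i, B (a i)) -> Q a) ->
  forall a, Q a.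
Proof.
move=> Bgen Qcl BQ a.
suff H j : forall a : power 'I_k D, (forall i : 'I_k, j <= i -> B (a i)) -> Q a.
  by apply: (H k) => i; rewrite leqNgt ltn_ord.
elim: j => [|j IH] {}a aB; first by apply: BQ => i; apply: aB.
case: (ltnP j k) => [jk|kj]; last first.
  apply: IH => i ji.
  by have := leq_trans (ltn_ord i) (leq_trans kj ji); rewrite ltnn.
pose o := Ordinal jk.
pose upd x : power 'I_k D := fun i => if i == o then x else a i.
have -> : a = upd (a o) by apply: funext => i; rewrite /upd; case: eqP => // ->.
have updc : continuous upd.
  apply: power_continuous => i; rewrite /upd.
  by case: eqP => _; [exact: id_continuous|exact: const_continuous].
apply: (Bgen (fun x => Q (upd x))) => [P s PQ dP sP|x Bx].
  apply: (Qcl (upd @` P)) => [_ [x Px <-]||]; first exact: PQ.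
    exact: directed_image updc.1 dP.
  exact: updc.2.
apply: IH => i ji; rewrite /upd; case: eqP => // io.
apply: aB; rewrite ltn_neqAle ji andbT; apply/eqP => jE; apply: io.
exact: val_inj.
Qed.

Lemma le_lub_closed (A B : dcpo) (f g : cmap A B) :
  lub_closed [set x | f x ⊑ g x].
Proof.
move=> P s Pfg dP sP; apply: (cmap_lub f dP sP).2 => _ [x Px <-].
exact: dle_trans (Pfg x Px) (cmap_mono g (sP.1 x Px)).
Qed.

End Generation.

(** * Kan extensions along the embedding of finite sets *)

Section KanExtension.
Local Open Scope classical_set_scope.
Variables (G : dfunctor Setfin DCPO) (X : dcpo).

Definition stage (n : nat) : dcpo := G 'I_n.

Definition act (n m : nat) (f : 'I_n -> 'I_m) : cmap (stage n) (stage m) :=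
  fmap G (f : hom ('I_n : Setfin) 'I_m).

Lemma act_id (n : nat) (t : stage n) : act id t = t.
Proof. by rewrite /act (fmap_id G 'I_n). Qed.

Lemma act_comp (n m p : nat) (g : 'I_m -> 'I_p) (f : 'I_n -> 'I_m) (t : stage n) :
  act (g \o f) t = act g (act f t).
Proof. by rewrite /act (@fmap_comp _ _ G 'I_n 'I_m 'I_p g f). Qed.

(** Indexing by natural numbers instead of all finite types keeps the type of
    families small enough to be the carrier of a dcpo. *)
Definition family := forall n : nat, ('I_n -> X) -> stage n -> Prop.

Definition sub_family (I J : family) : Prop :=
  forall n u t, I n u t -> J n u t.

(** Ideals are the compatible families of Scott-closed sets, that is, the cocones
    with values in the two-element chain, the bottom element meaning membership. *)
Record is_ideal (I : family) : Prop := {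
  ideal_act : forall (n m : nat) (f : 'I_n -> 'I_m) u t,
    I n (u \o f) t <-> I m u (act f t);
  ideal_down : forall (n : nat) (u v : power 'I_n X) t s,
    u ⊑ v -> t ⊑ s -> I n v s -> I n u t;
  ideal_lubl : forall (n : nat) (P : set (power 'I_n X)) u t,
    directed dle P -> is_lub dle P u -> (forall v, P v -> I n v t) -> I n u t;
  ideal_lubr : forall (n : nat) u (P : set (stage n)) t,
    directed dle P -> is_lub dle P t -> (forall s, P s -> I n u s) -> I n u t
}.

Definition closure (I : family) : family :=
  fun n u t => forall J, is_ideal J -> sub_family I J -> J n u t.

Lemma closure_sub I : sub_family I (closure I).
Proof. by move=> n u t It J _; apply. Qed.

Lemma closure_min I J : is_ideal J -> sub_family I J -> sub_family (closure I) J.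
Proof. by move=> Ji IJ n u t; apply. Qed.

Lemma closure_ideal I : is_ideal (closure I).
Proof.
split=> [n m f u t|n u v t s uv ts It J Ji IJ|n P u t dP uP It J Ji IJ|
         n u P t dP tP It J Ji IJ].
- by split=> It J Ji IJ; apply/(ideal_act Ji f u t); apply: It.
- exact: (ideal_down Ji uv ts (It J Ji IJ)).
- by apply: (ideal_lubl Ji dP uP) => v /It; apply.
- by apply: (ideal_lubr Ji dP tP) => s /It; apply.
Qed.

Definition ideal_le : Relation_Definitions.relation {I | is_ideal I} :=
  fun I J => sub_family (sval I) (sval J).

Lemma ideal_order : Relation_Definitions.order {I | is_ideal I} ideal_le.
Proof.
split=> [I n u t //|I J H IJ JH n u t /IJ/JH //|[I Ii] [J Ji] IJ JI].
apply: eq_exist; apply: functional_extensionality_dep => n.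
apply: funext => u; apply: funext => t; apply: propext.
by split; [apply: IJ|apply: JI].
Qed.

Definition family_union (P : set {I | is_ideal I}) : family :=
  fun n u t => exists2 I, P I & sval I n u t.

Lemma family_union_lub (P : set {I | is_ideal I}) :
  is_lub ideal_le P (exist _ (closure (family_union P)) (closure_ideal _)).
Proof.
split=> [I PI n u t It|J PJ]; first by apply: closure_sub; exists I.
by apply: closure_min (svalP J) _ => n u t [I /PJ]; apply.
Qed.

Lemma ideal_complete (P : set {I | is_ideal I}) :
  directed ideal_le P -> exists s, is_lub ideal_le P s.
Proof. by move=> _; eexists; exact: family_union_lub. Qed.

Definition Ideal : dcpo := Dcpo ideal_order ideal_complete.

Lemma Ideal_lub (P : set Ideal) (s : Ideal) : is_lub dle P s ->
  sub_family (sval s) (closure (family_union P)).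
Proof.
by move=> sP; rewrite (lub_unique sP (family_union_lub P : is_lub (@dle Ideal) P _)).
Qed.

(** What naturality, used in the direction of act only, forces into a family that
    contains t at u. *)
Definition ray (n : nat) (u : 'I_n -> X) (t : stage n) : family :=
  fun (m : nat) v s => exists2 f : 'I_n -> 'I_m, v \o f = u & s = act f t.

Definition principal (n : nat) (u : 'I_n -> X) (t : stage n) : Ideal :=
  exist _ (closure (ray u t)) (closure_ideal _).

Lemma ray_refl (n : nat) (u : 'I_n -> X) t : ray u t u t.
Proof. by exists id => //; rewrite act_id. Qed.

Lemma ray_sub (n : nat) (u : 'I_n -> X) t J :
  is_ideal J -> J n u t -> sub_family (ray u t) J.
Proof. by move=> Ji Jt m v _ [f fu ->]; apply/(ideal_act Ji f v t); rewrite fu. Qed.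

Lemma principal_le (n : nat) (u : 'I_n -> X) t (J : Ideal) :
  principal u t ⊑ J <-> sval J n u t.
Proof.
split=> [uJ|Jt]; first by apply: uJ; apply: closure_sub; exact: ray_refl.
by apply: closure_min (svalP J) _; exact: ray_sub (svalP J) Jt.
Qed.

Definition principals : set Ideal := fun I => exists n u t, I = @principal n u t.

(** Not every ideal arises from principal ones by directed joins, and one join may
    not suffice, whence the hull. *)
Definition lan : dcpo := sub_dcpo (@lub_hull_closed Ideal principals).

Lemma is_principal (n : nat) (u : 'I_n -> X) t : lub_hull principals (principal u t).
Proof. by apply: lub_hull_sub; exists n, u, t. Qed.

Definition germ (n : nat) (u : 'I_n -> X) (t : stage n) : lan :=
  exist _ (principal u t) (is_principal u t).

Definition germs : set lan := fun x => exists n u t, x = @germ n u t.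

Lemma germ_le (n : nat) (u : 'I_n -> X) t (x : lan) :
  germ u t ⊑ x <-> sval (sval x) n u t.
Proof. exact: principal_le. Qed.

Lemma germ_in (n : nat) (u : 'I_n -> X) t : sval (sval (germ u t)) n u t.
Proof. exact/germ_le/dle_refl. Qed.

Lemma lan_ideal (x : lan) : is_ideal (sval (sval x)).
Proof. exact: svalP. Qed.

Lemma lan_generated : generates germs.
Proof.
move=> Q Qcl gQ; apply: lub_hull_generated Qcl _ => -[x hx] [n [u [t xE]]].
by apply: gQ; exists n, u, t; exact: eq_exist.
Qed.

Lemma germ_act (n m : nat) (f : 'I_n -> 'I_m) u t :
  germ (u \o f) t = germ u (act f t).
Proof.
apply: dle_anti; apply/germ_le.
  by apply/(ideal_act (lan_ideal (germ u (act f t))) f u t); exact: germ_in.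
by apply/(ideal_act (lan_ideal (germ (u \o f) t)) f u t); exact: germ_in.
Qed.

Lemma germ_mono (n : nat) (u v : power 'I_n X) t s :
  u ⊑ v -> t ⊑ s -> germ u t ⊑ germ v s.
Proof.
move=> uv ts; apply/germ_le.
by apply: (ideal_down (lan_ideal (germ v s)) uv ts); exact: germ_in.
Qed.

Lemma germ_continuousl (n : nat) (t : stage n) :
  @continuous (power 'I_n X) lan (fun u => germ u t).
Proof.
split=> [u v uv|P u dP uP]; first exact: germ_mono uv (dle_refl t).
split=> [_ [v Pv <-]|x xP]; first exact: germ_mono (uP.1 v Pv) (dle_refl t).
apply/germ_le; apply: (ideal_lubl (lan_ideal x) dP uP) => v Pv.
by apply/germ_le; apply: xP; exists v.
Qed.

Lemma germ_continuousr (n : nat) (u : 'I_n -> X) : continuous (germ u).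
Proof.
split=> [t s ts|P t dP tP]; first exact: germ_mono (dle_refl _) ts.
split=> [_ [s Ps <-]|x xP]; first exact: germ_mono (dle_refl _) (tP.1 s Ps).
apply/germ_le; apply: (ideal_lubr (lan_ideal x) dP tP) => s Ps.
by apply/germ_le; apply: xP; exists s.
Qed.

(** The common stage is the disjoint union of the given ones, and u is the
    copairing of the given maps into X. *)
Lemma germs_common k (a : 'I_k -> lan) : (forall i, germs (a i)) ->
  exists n (u : 'I_n -> X) (t : 'I_k -> stage n), forall i, a i = germ u (t i).
Proof.
move=> ag.
have /choice[w aw] i :
    exists w : {n : nat & (('I_n -> X) * stage n)%type},
      a i = germ (projT2 w).1 (projT2 w).2.
  by have [n [u [t ->]]] := ag i; exists (existT _ n (u, t)).
pose N := {i : 'I_k & 'I_(projT1 (w i))}.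
pose inj i (x : 'I_(projT1 (w i))) : 'I_#|{: N}| := enum_rank (Tagged _ x).
pose u (j : 'I_#|{: N}|) : X :=
  let p := enum_val j in (projT2 (w (tag p))).1 (tagged p).
exists #|{: N}|, u, (fun i => act (@inj i) (projT2 (w i)).2) => i.
rewrite aw -germ_act; congr germ; apply: funext => x.
by rewrite /u /= /inj enum_rankK.
Qed.

Section Descent.
Variables (Y : dcpo)
  (α : forall n : nat, cmap (power 'I_n X) (cmap_dcpo (stage n) Y)).
Arguments α : clear implicits.
Hypothesis α_act : forall (n m : nat) (f : 'I_n -> 'I_m) u t,
  α n (u \o f) t = α m u (act f t).

Definition below (y : Y) : family := fun n u t => α n u t ⊑ y.

Lemma below_ideal y : is_ideal (below y).
Proof.
rewrite /below; split=> [n m f u t|n u v t s uv ts vs|n P u t dP uP Py|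
                          n u P t dP tP Py].
- by rewrite α_act.
- apply: dle_trans vs; apply: dle_trans (cmap_mono (α n v) ts).
  exact: (cmap_mono (α n) uv t).
- have := cmap_lub_at t (directed_image (@cmap_mono _ _ (α n)) dP)
    (cmap_lub (α n) dP uP).
  by case=> _; apply => _ [_ [v /Py vy <-] <-].
- by apply: (cmap_lub (α n u) dP tP).2 => _ [s /Py sy <-].
Qed.

(** The value at x is the least y whose ideal contains x.  For a germ this is
    prescribed by α, and a directed join of elements with such a y has the join
    of these y as its own. *)
Lemma lan_descent :
  exists h : cmap lan Y, forall n u t, h (germ u t) = α n u t.
Proof.
pose meets (x : lan) y :=
  forall z, sub_family (sval (sval x)) (below z) <-> y ⊑ z.
have meets_germ n u t : meets (germ u t) (α n u t).
  move=> z; split=> [|uz]; first by apply; apply: closure_sub; exact: ray_refl.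
  by apply: closure_min (below_ideal z) _; apply: ray_sub uz; exact: below_ideal.
have meets_mono x x' y y' : meets x y -> meets x' y' -> x ⊑ x' -> y ⊑ y'.
  move=> xy xy' xx; apply/xy => n u t /xx; apply: (xy' y').2; exact: dle_refl.
have meets_lub (P : set lan) x (R : set Y) y : directed dle P ->
    is_lub dle P x -> (forall p, P p -> exists2 r, R r & meets p r) ->
    (forall r, R r -> exists2 p, P p & meets p r) -> is_lub dle R y -> meets x y.
  move=> dP xP PR RP yR z; split=> [xz|yz].
    apply: yR.2 => r /RP[p Pp pr]; apply/pr => n u t pt; apply: xz.
    exact: xP.1 Pp _ _ _ pt.
  move=> n u t xt; have := Ideal_lub (sub_lub_at dP xP) xt; apply.
    exact: below_ideal.
  move=> m v s [_ [p /PR[r Rr pr] <-]]; apply: (pr z).2.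
  exact: dle_trans (yR.1 _ Rr) yz.
have total x : exists y, meets x y.
  apply: (@lan_generated (fun x => exists y, meets x y)) =>
    {x} [P s PQ dP sP|_ [n [u [t ->]]]]; last first.
    by exists (α n u t).
  pose R : set Y := fun r => exists2 p, P p & meets p r.
  have /dle_complete[y yR] : directed dle R.
    have [[p Pp] dP2] := dP; split.
      by have [r pr] := PQ _ Pp; exists r, p.
    move=> r r' [q Pq qr] [q' Pq' qr'].
    have [w [Pw qw qw']] := dP2 _ _ Pq Pq'; have [z wz] := PQ _ Pw.
    by exists z; split; [exists w|apply: meets_mono qr wz _|apply: meets_mono qr' wz _].
  exists y; apply: meets_lub dP sP _ _ yR => // p Pp.
  by have [r pr] := PQ _ Pp; exists r => //; exists p.
have [h hP] := choice total.
have hm : monotone h by move=> x y; exact: meets_mono.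
have hc : continuous h.
  split=> // P s dP sP.
  have [y yP] := dle_complete (directed_image hm dP).
  have sy : meets s y.
    apply: meets_lub dP sP _ _ yP => [p Pp|_ [p Pp <-]]; last by exists p.
    by exists (h p) => //; exists p.
  suff -> : h s = y by [].
  by apply: dle_anti; apply: meets_mono (dle_refl s).
exists (Cmap hc) => n u t /=.
by apply: dle_anti; apply: meets_mono (dle_refl (germ u t)).
Qed.

End Descent.
End KanExtension.

(** * The algebra structure of a Kan extension of algebras *)

Section KanAlgebra.
Local Open Scope classical_set_scope.
Variables (S : signature) (G : dfunctor Setfin (AlgCat S)) (X : dcpo).
Let D := functor_comp (forget S) G.

Definition stage_op (s : S) (n : nat) :
  cmap (power 'I_(arity s) (stage D n)) (stage D n) :=
  alg_op (G 'I_n : algebra S) s.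

Lemma act_op s n m (f : 'I_n -> 'I_m) (t : 'I_(arity s) -> stage D n) :
  act D f (stage_op s n t) = stage_op s m (fun i => act D f (t i)).
Proof. exact: (svalP (fmap G (f : hom ('I_n : Setfin) 'I_m)) s t). Qed.

(** Only this half of naturality is needed to move two elements of families to
    a common stage; unlike being an ideal, it holds for rays and for unions. *)
Definition stable (I : family D X) : Prop :=
  forall (n m : nat) (f : 'I_n -> 'I_m) u t, I n (u \o f) t -> I m u (act D f t).

Lemma ideal_stable I : is_ideal I -> stable I.
Proof. by move=> Ii n m f u t /(ideal_act Ii). Qed.

Lemma ray_stable n (u : 'I_n -> X) (t : stage D n) : stable (ray u t).
Proof. by move=> m p f v _ [g <- ->]; exists (f \o g) => //; rewrite act_comp. Qed.

Definition maps_into s (a : 'I_(arity s) -> family D X) (J : family D X) : Prop :=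
  forall (n : nat) u (t : 'I_(arity s) -> stage D n),
    (forall i, a i n u (t i)) -> J n u (stage_op s n t).

Definition copair n m (u : 'I_n -> X) (v : 'I_m -> X) : 'I_(n + m) -> X :=
  fun k => match fintype.split k with inl i => u i | inr j => v j end.

Lemma copair_lshift n m (u : 'I_n -> X) (v : 'I_m -> X) :
  copair u v \o @lshift n m = u.
Proof. by apply: funext => i /=; rewrite /copair (unsplitK (inl i)). Qed.

Lemma copair_rshift n m (u : 'I_n -> X) (v : 'I_m -> X) :
  copair u v \o @rshift n m = v.
Proof. by apply: funext => i /=; rewrite /copair (unsplitK (inr i)). Qed.

Lemma copair_continuous n m (v : 'I_m -> X) :
  @continuous (power 'I_n X) (power 'I_(n + m) X) (fun u => copair u v).
Proof.
apply: power_continuous => k; rewrite /copair.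
case: (fintype.split k) => i; last exact: const_continuous.
by split=> [u w|P u dP uP]; [apply|exact: power_lub_at].
Qed.

(** The operation applied after moving x and t to the disjoint union of their
    stages. *)
Definition plug s n m (i : 'I_(arity s)) (x : stage D n)
  (t : 'I_(arity s) -> stage D m) : stage D (n + m) :=
  stage_op s (n + m)
    (fun j => if j == i then act D (@lshift n m) x else act D (@rshift n m) (t j)).

Lemma plug_continuous s n m i (t : 'I_(arity s) -> stage D m) :
  continuous (fun x : stage D n => plug i x t).
Proof.
pose c (x : stage D n) : power 'I_(arity s) (stage D (n + m)) :=
  fun j => if j == i then act D (@lshift n m) x else act D (@rshift n m) (t j).
have cc : continuous c.
  apply: power_continuous => j; rewrite /c.
  by case: eqP => _; [exact: cfunP|exact: const_continuous].
exact: (cfunP (ccomp (stage_op s (n + m)) (Cmap cc))).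
Qed.

Lemma plug_act s n n' m (f : 'I_n -> 'I_n') i (x : stage D n)
    (t : 'I_(arity s) -> stage D m) (u : 'I_n' -> X) (v : 'I_m -> X) J :
  is_ideal J ->
  J (n + m) (copair (u \o f) v) (plug i x t) <->
  J (n' + m) (copair u v) (plug i (act D f x) t).
Proof.
move=> Ji; pose g (k : 'I_(n + m)) : 'I_(n' + m) :=
  match fintype.split k with inl a => lshift m (f a) | inr b => rshift n' b end.
have gl : g \o @lshift n m = @lshift n' m \o f.
  by apply: funext => k; rewrite /= /g (unsplitK (inl k)).
have gr : g \o @rshift n m = @rshift n' m.
  by apply: funext => k; rewrite /= /g (unsplitK (inr k)).
have -> : copair (u \o f) v = copair u v \o g.
  apply: funext => k; rewrite /= {1}/copair /g.
  by case: (fintype.split k) => a; rewrite /copair ?(unsplitK (inl _)) ?(unsplitK (inr _)).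
have -> : plug i (act D f x) t = act D g (plug i x t).
  rewrite act_op; congr (stage_op s _ _); apply: funext => j.
  by case: eqP => _; rewrite -!act_comp ?gl ?gr.
exact: (ideal_act Ji).
Qed.

(** The largest stable family that can stand in argument i if s is to map into J,
    the others being fixed.  Using independent stages n and m makes closure under
    joins in u visible: u varies freely on the summand n.  With a common stage, u
    would be tied to the values of the other arguments. *)
Definition residual s (a : 'I_(arity s) -> family D X) i (J : family D X) :
  family D X :=
  fun n u x => forall (m : nat) v (t : 'I_(arity s) -> stage D m),
    (forall j, j != i -> a j m v (t j)) -> J (n + m) (copair u v) (plug i x t).

Lemma residual_ideal s (a : 'I_(arity s) -> family D X) i J :
  is_ideal J -> is_ideal (residual a i J).
Proof.
move=> Ji; split.
- move=> n m f u x.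
  by split=> H p v t /H Jt; apply/(plug_act f i x t u v Ji).
- move=> n u v x y uv xy H m w t /H.
  exact: (ideal_down Ji ((copair_continuous n w).1 _ _ uv)
    ((plug_continuous n i t).1 _ _ xy)).
- move=> n P u x dP uP H m v t at_.
  apply: (ideal_lubl Ji (directed_image (copair_continuous n v).1 dP)
    ((copair_continuous n v).2 _ _ dP uP)) => _ [w Pw <-].
  exact: H.
- move=> n u P x dP xP H m v t at_.
  apply: (ideal_lubr Ji (directed_image (plug_continuous n i t).1 dP)
    ((plug_continuous n i t).2 _ _ dP xP)) => _ [w Pw <-].
  exact: H.
Qed.

Lemma residualP s (a : 'I_(arity s) -> family D X) i J :
  is_ideal J -> (forall j, stable (a j)) ->
  maps_into a J <-> sub_family (a i) (residual a i J).
Proof.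
move=> Ji ast; split=> [aJ n u x ax m v t at_|aQ n u t at_].
  apply: aJ => j; case: (eqVneq j i) => [->|ji].
    by apply: ast; rewrite copair_lshift.
  by apply: ast; rewrite copair_rshift; exact: at_.
have := aQ _ _ _ (at_ i) n u t (fun j _ => at_ j).
(* A common stage n is recovered from n + n along the codiagonal. *)
pose codiag (k : 'I_(n + n)) : 'I_n :=
  match fintype.split k with inl x => x | inr x => x end.
have -> : copair u u = u \o codiag.
  by apply: funext => k; rewrite /copair /codiag /=; case: (fintype.split k).
move/(ideal_act Ji); rewrite act_op; congr (J _ _ (stage_op _ _ _)).
have fl : codiag \o @lshift n n = id.
  by apply: funext => k; rewrite /= /codiag (unsplitK (inl k)).
have fr : codiag \o @rshift n n = id.
  by apply: funext => k; rewrite /= /codiag (unsplitK (inr k)).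
apply: funext => j; case: eqP => [->|_]; rewrite -act_comp ?fl ?fr; exact: act_id.
Qed.

(** Replacing argument i leaves its residual unchanged, and the residual is an
    ideal, so it contains the closure of whatever it contains. *)
Lemma maps_into_closure1 s (a : 'I_(arity s) -> family D X) i J :
  is_ideal J -> (forall j, stable (a j)) -> maps_into a J ->
  maps_into (fun j => if j == i then closure (a j) else a j) J.
Proof.
move=> Ji ast aJ.
have bst j : stable (if j == i then closure (a j) else a j).
  by case: eqP => // _; apply: ideal_stable; exact: closure_ideal.
apply/(residualP i Ji bst); rewrite eqxx.
apply: closure_min; first exact: residual_ideal.
move=> n u x /((residualP i Ji ast).1 aJ) H m v t bt; apply: H => j ji.
by have := bt j ji; rewrite (negPf ji).
Qed.

Lemma maps_into_closure s (a : 'I_(arity s) -> family D X) J :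
  is_ideal J -> (forall j, stable (a j)) -> maps_into a J ->
  maps_into (fun j => closure (a j)) J.
Proof.
move=> Ji ast aJ.
pose b (k : nat) (j : 'I_(arity s)) := if j < k then closure (a j) else a j.
have bst k j : stable (b k j).
  by rewrite /b; case: ltnP => // _; apply: ideal_stable; exact: closure_ideal.
suff H k : maps_into (b k) J.
  by move=> n u t ct; apply: (H (arity s)) => i; rewrite /b ltn_ord.
elim: k => [//|k IH]; case: (ltnP k (arity s)) => [ks|sk]; last first.
  move=> n u t bt; apply: IH => i; have := bt i.
  have ik : i < k := leq_trans (ltn_ord i) sk.
  by rewrite /b ltnS (ltnW ik) ik.
have H := @maps_into_closure1 _ _ (Ordinal ks) _ Ji (bst k) IH.
move=> n u t bt; apply: H => i; have := bt i.
rewrite /b ltnS leq_eqVlt -val_eqE /=.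
by case: eqP => [->|_] //=; rewrite ltnn.
Qed.

Definition op_family s (a : 'I_(arity s) -> family D X) : family D X :=
  fun n u x => exists2 t, forall i, a i n u (t i) & x = stage_op s n t.

Definition op_ideal s (a : 'I_(arity s) -> Ideal D X) : Ideal D X :=
  exist _ (closure (op_family (fun i => sval (a i)))) (closure_ideal _).

Lemma op_ideal_le s (a : 'I_(arity s) -> Ideal D X) (J : Ideal D X) :
  op_ideal a ⊑ J <-> maps_into (fun i => sval (a i)) (sval J).
Proof.
split=> [aJ n u t at_|aJ].
  by apply: aJ; apply: closure_sub; exists t.
by apply: closure_min (svalP J) _ => n u _ [t at_ ->]; exact: aJ.
Qed.

(** By maps_into_closure the principal ideals may be replaced by rays.  Elements of
    the rays at a stage m are images of the t i under maps f i that depend on i;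
    these are the restrictions of one map on the product of arity s and n, on
    which the t i can be placed in separate copies. *)
Lemma op_ideal_principal s n (u : 'I_n -> X) (t : 'I_(arity s) -> stage D n) :
  op_ideal (fun i => principal u (t i)) = principal u (stage_op s n t).
Proof.
apply: dle_anti; last first.
  apply/principal_le; apply: closure_sub; exists t => // i.
  apply: closure_sub; exact: ray_refl.
set J := principal _ _; have Ji : is_ideal (sval J) := svalP J.
apply/op_ideal_le.
apply: (maps_into_closure (a := fun i => ray u (t i)) Ji) => [j|m v x rx].
  exact: ray_stable.
have /choice[f fP] i : exists f : 'I_n -> 'I_m, v \o f = u /\ x i = act D f (t i).
  by have [f ? ?] := rx i; exists f.
pose N := #|{: 'I_(arity s) * 'I_n}|.
pose inj i (k : 'I_n) : 'I_N := enum_rank (i, k).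
pose codiag (k : 'I_N) : 'I_n := (enum_val k).2.
pose F (k : 'I_N) : 'I_m := f (enum_val k).1 (enum_val k).2.
have -> : x = fun i => act D F (act D (inj i) (t i)).
  apply: funext => i; rewrite -act_comp (fP i).2; congr (act D _ _).
  by apply: funext => k; rewrite /= /F enum_rankK.
rewrite -act_op; apply/(ideal_act Ji F v).
have -> : v \o F = u \o codiag.
  by apply: funext => k; rewrite /= /F -{1}(fP (enum_val k).1).1.
apply/(ideal_act Ji codiag u); rewrite act_op.
have -> : (fun i => act D codiag (act D (inj i) (t i))) = t.
  apply: funext => i; rewrite -act_comp -[RHS]act_id; congr (act D _ _).
  by apply: funext => k; rewrite /= /codiag enum_rankK.
apply: closure_sub; exact: ray_refl.
Qed.

Definition lan_op_ideal s (a : power 'I_(arity s) (lan D X)) : Ideal D X :=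
  op_ideal (fun i => sval (a i)).

(** A join of ideals is the closure of their union.  Elements of the unions are
    elements of one single tuple of P, because the arity is finite and P is
    directed; so maps_into_closure applies to the unions. *)
Lemma lan_op_ideal_continuous s : continuous (@lan_op_ideal s).
Proof.
have mono : monotone (@lan_op_ideal s).
  move=> a b ab; apply/op_ideal_le => n u t at_.
  have /op_ideal_le := dle_refl (lan_op_ideal b); apply => i.
  exact: ab i _ _ _ (at_ i).
split=> // P a dP aP; split=> [_ [p Pp <-]|J PJ]; first exact: mono (aP.1 p Pp).
pose U i : family D X :=
  fun n u t => exists2 p : power _ (lan D X), P p & sval (sval (p i)) n u t.
have Ust i : stable (U i).
  by move=> n m f u t [p Pp pt]; exists p => //; apply: ideal_stable pt; exact: lan_ideal.
have UJ : maps_into U (sval J).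
  move=> n u t Ut; have /choice[p pP] i :
      exists p : power _ (lan D X), P p /\ sval (sval (p i)) n u (t i).
    by have [p ? ?] := Ut i; exists p.
  have [z Pz pz] := directed_finite dP (fun i => (pP i).1).
  have /op_ideal_le : lan_op_ideal z ⊑ J by apply: PJ; exists z.
  by apply => i; apply: pz (pP i).2.
apply/op_ideal_le => n u t at_.
apply: (maps_into_closure (svalP J) Ust UJ) => i.
have := Ideal_lub (sub_lub_at (power_directed i dP) (power_lub_at i dP aP)) (at_ i).
apply; first exact: closure_ideal.
move=> m v x [_ [_ [p Pp <-] <-] px]; apply: closure_sub; by exists p.
Qed.

(** The operations on ideals restrict to the elements of the Kan extension, since
    they preserve directed joins and the tuples of germs generate. *)
Lemma lan_op_in s (a : power 'I_(arity s) (lan D X)) :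
  lub_hull (@principals D X) (lan_op_ideal a).
Proof.
have [opm opl] := lan_op_ideal_continuous s.
apply: (@generates_power _ _ _ (fun a => lub_hull (@principals D X) (lan_op_ideal a))
  (@lan_generated D X)) => {a} [P a PQ dP aP|a /germs_common[n [u [t aE]]]].
  apply: (@lub_hull_closed _ _ (@lan_op_ideal s @` P)) => [_ [b Pb <-]||].
  - exact: PQ.
  - exact: directed_image.
  - exact: opl.
have -> : a = fun i => germ u (t i) by apply: funext.
by rewrite /lan_op_ideal op_ideal_principal; exact: is_principal.
Qed.

Lemma lan_op_continuous s :
  @continuous (power 'I_(arity s) (lan D X)) (lan D X)
    (fun a => exist _ (lan_op_ideal a) (lan_op_in a)).
Proof.
have [opm opl] := lan_op_ideal_continuous s.
split=> [a b /opm //|P a dP aP]; apply: sub_lubP; rewrite image_comp.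
exact: opl.
Qed.

Definition lan_algebra : algebra S :=
  Algebra (fun s => Cmap (@lan_op_continuous s)).

Definition germ_map n (u : 'I_n -> X) : cmap (G 'I_n : algebra S) lan_algebra :=
  Cmap (@germ_continuousr D X n u).

Lemma germ_is_hom n (u : 'I_n -> X) : is_hom (germ_map u).
Proof. by move=> s t; apply: eq_exist; rewrite [RHS]op_ideal_principal. Qed.

End KanAlgebra.

(** * Evaluation of terms and directed joins *)

Section Evaluation.
Local Open Scope classical_set_scope.
Variables (S : signature) (V : Type).

Lemma vars_finite (t : preterm S V) : is_term t -> finite_set (vars t).
Proof.
elim=> [x|s u _ IH|α u _ _ //]; first exact: finite_set1.
by apply: bigcup_finite => [|i _]; [exact: finite_finset|exact: IH].
Qed.

Lemma chain_directed (D : dcpo) (α : ordinal_le S) (a : α -> D) :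
  (forall k l, ord_leq k l -> a k ⊑ a l) -> directed dle (range a).
Proof.
move=> am; split.
  have [x Ax] := ord_nonzero α.
  by exists (a (exist _ x (mem_set Ax))); exists (exist _ x (mem_set Ax)).
move=> _ _ [k _ <-] [l _ <-]; case: (ord_lt_total k l) => [kl|->|lk].
- exists (a l); split; [by exists l|by apply: am; left|exact: dle_refl].
- exists (a l); split; [by exists l|exact: dle_refl|exact: dle_refl].
- exists (a k); split; [by exists k|exact: dle_refl|by apply: am; left].
Qed.

Lemma eval_vars (A : algebra S) (f g : V -> A) (t : preterm S V) b :
  (forall x, vars t x -> f x = g x) -> eval f t b -> eval g t b.
Proof.
elim: t b => [x|s t IH|α t IH] b /= fg.
- by move=> ->; exact: fg.
- move=> [a [ta ->]]; exists a; split=> // i.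
  by apply: IH (ta i) => x tx; apply: fg; exists i.
- move=> [a [ta am ab]]; exists a; split=> // k.
  by apply: IH (ta k) => x tx; apply: fg; exists k.
Qed.

Lemma eval_hom (A B : algebra S) (h : cmap A B) (f : V -> A) (t : preterm S V) b :
  is_hom h -> eval f t b -> eval (h \o f) t (h b).
Proof.
move=> hh; elim: t b => [x|s t IH|α t IH] b /=; first by move=> ->.
- by move=> [a [ta ->]]; exists (h \o a); split=> [i|]; [exact: IH|exact: hh].
- move=> [a [ta am ab]]; exists (h \o a); split=> [k|k l kl|].
  + exact: IH.
  + exact/cmap_mono/am.
  + by rewrite -(image_comp a h); exact: cmap_lub (chain_directed am) ab.
Qed.

Lemma eval_mono (A : algebra S) (f g : V -> A) (t : preterm S V) b c :
  (forall x, f x ⊑ g x) -> eval f t b -> eval g t c -> b ⊑ c.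
Proof.
move=> fg; elim: t b c => [x|s t IH|α t IH] b c /=; first by move=> -> ->.
- move=> [a [ta ->]] [d [td ->]]; apply: cmap_mono => i.
  exact: IH (ta i) (td i).
- move=> [a [ta _ ab]] [d [td _ dc]]; apply: ab.2 => _ [k _ <-].
  by apply: dle_trans (IH _ _ _ (ta k) (td k)) _; apply: dc.1; exists k.
Qed.

Definition values (A : algebra S) (P : set (V -> A)) (t : preterm S V) : set A :=
  fun b => exists2 f, P f & eval f t b.

(** Evaluation is continuous on a directed set of interpretations at which the
    term is defined; in particular it is defined at the join. *)
Lemma eval_lub (A : algebra S) (P : set (power V A)) (g : power V A)
    (t : preterm S V) :
  directed dle P -> is_lub dle P g -> (forall f, P f -> exists b, eval f t b) ->
  exists2 b, eval g t b & is_lub dle (values P t) b.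
Proof.
move=> dP gP; elim: t => [x|s t IH|α t IH] Pt.
- exists (g x) => //; have := power_lub_at x dP gP; congr (is_lub _ _ _).
  by apply/seteqP; split=> [_ [f Pf <-]|y [f Pf /= ->]]; exists f.
- have /choice[b bP] i : exists b, eval g (t i) b /\ is_lub dle (values P (t i)) b.
    suff [b gb bP] : exists2 b, eval g (t i) b & is_lub dle (values P (t i)) b.
      by exists b.
    apply: IH => f Pf.
    by have [_ [a [ta _]]] := Pt f Pf; exists (a i); exact: ta.
  exists (alg_op A s b); first by exists b; split=> // i; exact: (bP i).1.
  pose R : set (power _ A) := fun a => exists2 f, P f & forall i, eval f (t i) (a i).
  have dR : directed dle R.
    have [[f Pf] dP2] := dP; split.
      by have [_ [a [ta _]]] := Pt f Pf; exists a, f.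
    move=> a a' [f' Pf' fa] [f'' Pf'' fa'].
    have [h [Ph fh fh']] := dP2 _ _ Pf' Pf''; have [_ [c [hc _]]] := Pt h Ph.
    exists c; split; first by exists h.
      by move=> i; exact: eval_mono fh (fa i) (hc i).
    by move=> i; exact: eval_mono fh' (fa' i) (hc i).
  have bR : is_lub dle R b.
    apply: power_lubP => i; have := (bP i).2; congr (is_lub _ _ _).
    apply/seteqP; split=> [x [f Pf fx]|_ [a [f Pf fa] <-]]; last by exists f.
    have [_ [a [fa _]]] := Pt f Pf; exists a; first by exists f.
    exact: eval_functional (fa i) fx.
  have := cmap_lub (alg_op A s) dR bR; congr (is_lub _ _ _).
  apply/seteqP; split=> [_ [a [f Pf fa] <-]|_ [f Pf [a [fa ->]]]].
    by exists f => //; exists a.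
  by exists a => //; exists f.
- have /choice[b bP] k : exists b, eval g (t k) b /\ is_lub dle (values P (t k)) b.
    suff [b gb bP] : exists2 b, eval g (t k) b & is_lub dle (values P (t k)) b.
      by exists b.
    apply: IH => f Pf.
    by have [_ [a [ta _ _]]] := Pt f Pf; exists (a k); exact: ta.
  have bm k l : ord_leq k l -> b k ⊑ b l.
    move=> kl; apply: (bP k).2.2 => x [f Pf fx].
    have [_ [a [fa am _]]] := Pt f Pf.
    rewrite (eval_functional fx (fa k)).
    by apply: dle_trans (am _ _ kl) _; apply: (bP l).2.1; exists f; last exact: fa.
  have [c cP] := dle_complete (chain_directed bm).
  exists c; first by exists b; split=> // k; exact: (bP k).1.
  split=> [x [f Pf [a [fa am ax]]]|z zP].
    apply: ax.2 => _ [k _ <-]; apply: (@dle_trans _ _ (b k)).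
      by apply: (bP k).2.1; exists f; last exact: fa.
    by apply: cP.1; exists k.
  apply: cP.2 => _ [k _ <-]; apply: (bP k).2.2 => x [f Pf fx].
  have [y [a [fa am ay]]] := Pt f Pf.
  rewrite (eval_functional fx (fa k)).
  apply: (@dle_trans _ _ y); first by apply: ay.1; exists k.
  by apply: zP; exists f => //; exists a.
Qed.

Lemma satisfies_lub_closed (A : algebra S) (t t' : preterm S V) :
  @lub_closed (power V A) [set f | exists b, eval f t b /\ eval f t' b].
Proof.
move=> P g PQ dP gP.
have [b gb bP] : exists2 b, eval g t b & is_lub dle (values P t) b.
  by apply: eval_lub dP gP _ => f /PQ[b [fb _]]; exists b.
have [c gc cP] : exists2 c, eval g t' c & is_lub dle (values P t') c.
  by apply: eval_lub dP gP _ => f /PQ[c [_ fc]]; exists c.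
exists b; split=> //; suff -> : b = c by [].
apply: lub_unique bP _; move: cP; congr (is_lub _ _ _).
apply/seteqP; split=> x [f Pf fx]; exists f => //.
  by have [y [fy fy']] := PQ f Pf; rewrite (eval_functional fx fy').
by have [y [fy fy']] := PQ f Pf; rewrite (eval_functional fx fy).
Qed.

(** Up to its values outside W, an interpretation is a finite, nonempty
    tuple: it is determined on W by precomposition with sec, and idx spreads a
    tuple back to all of V. *)
Lemma finite_support (W : set V) : ([set: V] #= [set: nat])%card ->
  finite_set W -> exists n (idx : V -> 'I_n.+1) (sec : 'I_n.+1 -> V),
    forall x, W x -> sec (idx x) = x.
Proof.
move=> /card_set_bijP[enc [_ enc_inj enc_surj]] Wfin.
have /choice[dec decK] k : exists x, enc x = k.
  by have [x _ <-] := enc_surj k I; exists x.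
have /finite_seqP[s sE] := finite_image enc Wfin.
exists (\max_(k <- s) k), (fun x => inord (enc x)), (fun i => dec (i : nat)) => x Wx.
apply: enc_inj; rewrite ?inE // decK inordK // ltnS.
apply: (@leq_bigmax_seq _ s xpredT (fun k : nat => k)) => //.
have : (enc @` W) (enc x) by exists x.
by rewrite sE.
Qed.

End Evaluation.

Section KanVariety.
Local Open Scope classical_set_scope.
Variables (S : signature) (V : Type).
Hypothesis V_countable : ([set: V] #= [set: nat])%card.
Variables (G : dfunctor Setfin (AlgCat S)) (X : dcpo).

(** Interpretations that factor through idx form a finite power of the
    Kan extension.  There it is enough to consider tuples of germs [u, c i], which
    are images of tuples of the algebra G n under a homomorphism. *)
Lemma lan_satisfies (e : term S V * term S V) :
  (forall n, satisfies (G 'I_n) e) -> satisfies (lan_algebra G X) e.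
Proof.
case: e => [[t tt] [t' tt']] /= Ge f; pose L := lan_algebra G X.
have Wfin : finite_set (vars t `|` vars t').
  by rewrite finite_setU; split; exact: vars_finite.
have [n [idx [sec secK]]] := finite_support V_countable Wfin.
pose spread (a : power 'I_n.+1 L) : power V L := a \o idx.
have sprc : continuous spread.
  apply: power_continuous => x.
  by split=> [a b|P a dP aP]; [apply|exact: power_lub_at].
have [b [tb tb']] : exists b, eval (spread (f \o sec)) t b /\
    eval (spread (f \o sec)) t' b.
  apply: (@generates_power _ _ _ (fun a : power 'I_n.+1 L =>
    exists b, eval (spread a) t b /\ eval (spread a) t' b)
    (@lan_generated _ X)) => [P a PQ dP aP|a /germs_common[m [u [c aE]]]].
    apply: (@satisfies_lub_closed _ _ L t t' (spread @` P)) => [_ [p Pp <-]||].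
    - exact: PQ.
    - exact: directed_image sprc.1 dP.
    - exact: sprc.2.
  have [b [cb cb']] := Ge m (c \o idx).
  have -> : spread a = germ_map G u \o (c \o idx) by apply: funext => x; exact: aE.
  exists (germ_map G u b); split; apply: eval_hom => //; exact: germ_is_hom.
by exists b; split; [apply: eval_vars tb|apply: eval_vars tb'] => x tx;
  rewrite /spread /= secK //; [left|right].
Qed.

End KanVariety.

(** * Free algebras are Kan extensions *)

Section FreeAlgebras.
Local Open Scope classical_set_scope.
Variables (S : signature) (V : Type).
Hypothesis V_countable : ([set: V] #= [set: nat])%card.
Variables (E : set (term S V * term S V)) (F : dfunctor DCPO (variety E)).
Variable adj : adjunction F (variety_forget E).

Let T : dfunctor DCPO DCPO := functor_comp (variety_forget E) F.

Definition free (X : dcpo) : algebra S := sval (F X).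

Definition free_unit (X : dcpo) : cmap X (free X) := adj_unit adj X.

Definition free_map (X Y : dcpo) (f : cmap X Y) : cmap (free X) (free Y) :=
  fmap T (f : hom (X : DCPO) Y).

Lemma free_map_is_hom (X Y : dcpo) (f : cmap X Y) : is_hom (free_map f).
Proof. exact: svalP (fmap F (f : hom (X : DCPO) Y)). Qed.

Lemma free_map_comp (X Y Z : dcpo) (g : cmap Y Z) (f : cmap X Y) x :
  free_map (ccomp g f) x = free_map g (free_map f x).
Proof.
exact: (congr1 (fun h : cmap (T X) (T Z) => h x)
  (@fmap_comp _ _ T X Y Z g f)).
Qed.

Lemma free_unit_natural (X Y : dcpo) (f : cmap X Y) x :
  free_map f (free_unit X x) = free_unit Y (f x).
Proof.
exact/esym/(congr1 (fun h : cmap X (T Y) => h x)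
  (naturality (adj_unit adj) (f : hom (X : DCPO) Y))).
Qed.

Lemma free_lift (X : dcpo) (B : algebra S) (f : cmap X B) : in_variety E B ->
  exists2 g : cmap (free X) B, is_hom g & forall x, g (free_unit X x) = f x.
Proof.
move=> BE; pose b : variety E := exist _ B BE.
pose c : alg_hom (free B) B := adj_counit adj b.
exists (ccomp (sval c) (free_map f)) => [s a|x /=].
  by rewrite /= free_map_is_hom (svalP c).
rewrite free_unit_natural.
exact: (congr1 (fun h : cmap B B => h (f x)) (triangleR adj b)).
Qed.

(** A homomorphism is the transpose of its restriction along the unit. *)
Lemma free_hom_ext (X : dcpo) (B : algebra S) (g h : cmap (free X) B) :
  in_variety E B -> is_hom g -> is_hom h ->
  (forall x, g (free_unit X x) = h (free_unit X x)) -> forall y, g y = h y.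
Proof.
move=> BE gh hh guhu y; pose b : variety E := exist _ B BE.
pose c : alg_hom (free B) B := adj_counit adj b.
have adjunct (k : cmap (free X) B) : is_hom k ->
    k y = sval c (free_map (ccomp k (free_unit X)) y).
  move=> kh; rewrite free_map_comp.
  have := congr1 (fun k : alg_hom (free (free X)) B =>
    sval k (free_map (free_unit X) y))
    (naturality (adj_counit adj) (exist _ k kh : hom (F X) b)).
  move=> /= ->; congr (k _); apply/esym.
  exact: (congr1 (fun k : alg_hom (free X) (free X) => sval k y) (triangleL adj X)).
by rewrite (adjunct g) // (adjunct h) //; congr (sval c (free_map _ y));
  exact: cmap_ext.
Qed.

Let G : dfunctor Setfin (AlgCat S) :=
  functor_comp (inclusion (in_variety E)) (functor_comp F K).
Let D : dfunctor Setfin DCPO := functor_comp (forget S) G.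

Section Point.
Variable X : dcpo.

Definition points n (u : 'I_n -> X) : cmap (discrete 'I_n) X :=
  Cmap (discrete_continuous (A := discrete 'I_n) u (fun x y xy => xy)).

Lemma points_continuous n :
  @continuous (power 'I_n X) (cmap_dcpo (discrete 'I_n) X) (@points n).
Proof.
split=> [u v uv i|P u dP uP]; first exact: uv.
apply: cmap_lubP => i; rewrite image_comp; exact: power_lub_at dP uP.
Qed.

Lemma lan_in_variety : in_variety E (lan_algebra G X).
Proof.
move=> e Ee; apply: (lan_satisfies V_countable) => n.
exact: (svalP (F (discrete 'I_n)) e Ee).
Qed.

Lemma free_unit_act n m (f : 'I_n -> 'I_m) i :
  act D f (free_unit (discrete 'I_n) i) = free_unit (discrete 'I_m) (f i).
Proof. exact: free_unit_natural. Qed.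

(** The unit of the Kan extension sends x to the germ of the generator of the
    free algebra on one point, placed at x.  Both sides of the equation are
    homomorphisms in t, so it is enough to compare them on generators. *)
Lemma free_to_lan :
  exists2 e : cmap (free X) (lan_algebra G X), is_hom e &
  forall n (u : 'I_n -> X) (t : stage D n), e (free_map (points u) t) = germ u t.
Proof.
pose one := free_unit (discrete 'I_1) ord0 : stage D 1.
pose j (x : X) : lan D X := germ (fun _ : 'I_1 => x) one.
have jc : continuous j.
  pose cst (x : X) : power 'I_1 X := fun _ => x.
  have cstc : continuous cst by apply: power_continuous => i; exact: id_continuous.
  pose g : cmap (power 'I_1 X) (lan D X) := Cmap (germ_continuousl X one).
  exact: (comp_continuous g (Cmap cstc)).
have [e eh ej] := free_lift (B := lan_algebra G X) (Cmap jc) lan_in_variety.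
exists e => // n u t.
apply: (free_hom_ext (g := ccomp e (free_map (points u))) (h := germ_map G u)) =>
  [||s a|i /=].
- exact: lan_in_variety.
- by move=> s a /=; rewrite free_map_is_hom eh.
- exact: germ_is_hom.
rewrite free_unit_natural ej /= /j.
have -> : free_unit (discrete 'I_n) i = act D (fun _ => i) one by rewrite free_unit_act.
by rewrite -germ_act.
Qed.

(** Being a homomorphism amounts to the equality of two continuous maps on a power
    of the Kan extension, so it may be checked on germs from a common stage. *)
Lemma lan_to_free :
  exists2 r : cmap (lan_algebra G X) (free X), is_hom r &
  forall n (u : 'I_n -> X) (t : stage D n), r (germ u t) = free_map (points u) t.
Proof.
pose α n : cmap (power 'I_n X) (cmap_dcpo (stage D n) (free X)) :=
  ccomp (fmap T : cmap (cmap_dcpo (discrete 'I_n) X) _)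
    (Cmap (@points_continuous n)).
have [|r rP] := @lan_descent D X (free X) α.
  move=> n m f u t /=.
  have -> : points (u \o f) = ccomp (points u) (Cmap (K_map_continuous f)).
    exact: cmap_ext.
  exact: free_map_comp.
exists r => [s|n u t]; last exact: rP.
have rc : continuous (fun a : power 'I_(arity s) (lan D X) =>
    (r \o a : power 'I_(arity s) (free X))).
  apply: power_continuous => i; apply: (cfunP (ccomp r (Cmap (_ : continuous _)))).
  by split=> [a b|P a dP aP]; [apply|exact: power_lub_at].
pose lhs := ccomp r (alg_op (lan_algebra G X) s).
pose rhs := ccomp (alg_op (free X) s) (Cmap rc).
suff lr (a : power 'I_(arity s) (lan D X)) : lhs a ⊑ rhs a /\ rhs a ⊑ lhs a.
  by move=> a; have [] := lr a; exact: dle_anti.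
have germs_eq (b : power 'I_(arity s) (lan D X)) :
    (forall i, germs (b i)) -> lhs b = rhs b.
  move=> /germs_common[n [u [t bE]]].
  have -> : b = fun i => germ u (t i) by apply: funext.
  have -> : lhs (fun i => germ u (t i)) = r (germ u (stage_op G s n t)).
    by have := germ_is_hom (G := G) u t; move=> /(congr1 r)/esym.
  rewrite rP [LHS]free_map_is_hom; congr (alg_op _ s _).
  by apply: funext => i /=; rewrite rP.
have lan_gen := @lan_generated D X.
split; [apply: (generates_power lan_gen (le_lub_closed (f := lhs) (g := rhs)))
       |apply: (generates_power lan_gen (le_lub_closed (f := rhs) (g := lhs)))];
  by move=> b /germs_eq /= ->; exact: dle_refl.
Qed.

End Point.

Lemma free_strongly_finitary : strongly_finitary T.
Proof.
move=> X Y restrict.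
have restrictE h (A : finType) (u : cmap (discrete A) X) t :
    (restrict h A u : cmap _ Y) t = (h : cmap (free X) Y) (free_map u t) by [].
have [e eh eP] := free_to_lan X; have [r rh rP] := lan_to_free X.
have re x : r (e x) = x.
  apply: (free_hom_ext (g := ccomp r e) (h := cid_map (free X))) => //.
  - exact: svalP (F X).
  - by move=> s a; rewrite /= eh rh.
  - move=> {}x /=; pose u (_ : 'I_1) := x.
    have -> : free_unit X x = free_map (points u) (free_unit (discrete 'I_1) ord0).
      by rewrite free_unit_natural.
    by rewrite eP rP.
split=> [h h'|α].
  split=> [hh A u t|hh x]; first by rewrite !restrictE; exact: hh.
  rewrite -(re x); move: (e x).
  apply: (@lan_generated D X [set y | (h : cmap _ Y) (r y) ⊑ (h' : cmap _ Y) (r y)]).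
    exact: (le_lub_closed (f := ccomp (h : cmap (free X) Y) r)
      (g := ccomp (h' : cmap (free X) Y) r)).
  by move=> _ [n [u [t ->]]] /=; rewrite rP; exact: hh.
pose β n : cmap (power 'I_n X) (cmap_dcpo (stage D n) Y) :=
  ccomp (α 'I_n) (Cmap (@points_continuous X n)).
have leg_act (A B : finType) (f : A -> B) (u : cmap (discrete B) X) t :
    α A (ccomp u (Cmap (K_map_continuous f))) t =
    α B u (free_map (Cmap (K_map_continuous f)) t).
  exact: (congr1 (fun k : cmap _ Y => k t) (leg_natural α (f : hom (A : Setfin) B) u)).
have [|h hP] := @lan_descent D X Y β.
  move=> n m f u t /=; rewrite -leg_act; congr (α _ _ t); exact: cmap_ext.
exists (ccomp h e) => A u; apply: cmap_ext => t.
rewrite restrictE.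
(* A finite type is replaced by the initial segment of its cardinality. *)
pose up := Cmap (K_map_continuous (@enum_rank A)).
pose v (i : 'I_#|A|) := u (enum_val i).
have uE : u = ccomp (points v) up.
  by apply: cmap_ext => x; rewrite /= /v enum_rankK.
rewrite {1}uE free_map_comp /= eP hP /=.
by rewrite -leg_act -uE.
Qed.

End FreeAlgebras.

Theorem theorem7p13 (S : signature) (V : Type)
    (V_countable : ([set: V] #= [set: nat])%card)
    (E : set (term S V * term S V))
    (F : dfunctor DCPO (variety E)) (adj : adjunction F (variety_forget E)) :
  strongly_finitary_monad (monad_of_adjunction adj).
Proof. exact: free_strongly_finitary. Qed.
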